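(* Let $p,q,a,b$ be positive integers with $2\leq a\leq b$. Maker has a winning strategy in the $(p,q)$-percolation game on $T_{a,b}$ if and only if \[p(b-2)-\Bigl\lceil\frac{p}{a}\Bigr\rceil (b-a)\geq q,\] irrespective of the choice of the root $v_0$.
   Context: For integers $2\leq a\leq b$, $T_{a,b}$ denotes the infinite bi-regular tree with vertices of two types, Type I and Type II: each vertex of Type I is adjacent to exactly $a$ vertices (all of Type II), while each vertex of Type II is adjacent to exactly $b$ vertices (all of Type I). The $(p,q)$-percolation game on $(\Lambda,v_0)$, where $\Lambda$ is an infinite connected (multi)graph, $v_0$ is a vertex of $\Lambda$ (the root) and $p,q$ are positive integers: two players, Maker and Breaker, play in alternating turns, with Maker playing first. Initially all edges of $\Lambda$ are marked as unsafe. On each of her turns, Maker marks $p$ unsafe edges as safe; on each of his turns, Breaker takes $q$ unsafe edges and deletes them from the graph. Breaker wins if at any time in the game the component containing $v_0$ (in the graph of edges not deleted) becomes finite. If Maker is able to ensure that $v_0$ remains in an infinite component indefinitely, then she is said to have a winning strategy. *)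

(* Defs.v *)
From HB Require Import structures.
From mathcomp Require Import all_boot all_order all_algebra finmap.
From mathcomp Require Import boolp classical_sets functions cardinality.
From Stdlib Require Import Relation_Operators.

Set Implicit Arguments.
Unset Strict Implicit.
Unset Printing Implicit Defensive.

Local Open Scope classical_set_scope.
Local Open Scope card_scope.

(* Loops and parallel edges are allowed; the order of the two ends of an edge
   is immaterial, see [joins]. *)
Record multigraph := Multigraph {
  vertex : choiceType;
  edge : choiceType;
  ends : edge -> vertex * vertex
}.

Section Graph.
Variable G : multigraph.
Implicit Types (u v w : vertex G) (e : edge G) (D : {fset edge G}).

Definition joins e u v : Prop := ends e = (u, v) \/ ends e = (v, u).

(* Adjacency in the graph obtained from G by deleting the edges in D. *)
Definition adjacent D u v : Prop := exists2 e, e \notin D & joins e u v.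

Definition component D v : set (vertex G) :=
  [set w | clos_refl_trans (vertex G) (adjacent D) v w].

Definition neighbours v : set (vertex G) := [set w | adjacent fset0 v w].

Definition connected_graph : Prop := forall u v, component fset0 u v.

(* [walk u [:: (e1, v1); ...; (en, vn)]] states that e1 joins u to v1, e2 joins
   v1 to v2, and so on. *)
Fixpoint walk u (s : seq (edge G * vertex G)) : Prop :=
  if s is (e, v) :: s' then joins e u v /\ walk v s' else True.

(* A loop is a cycle of length 1 and two parallel edges form one of length 2. *)
Definition is_cycle u (s : seq (edge G * vertex G)) : Prop :=
  [/\ s <> [::], walk u s, last u (unzip2 s) = u,
      uniq (unzip1 s) & uniq (unzip2 s)].

Definition is_tree : Prop :=
  connected_graph /\ forall u s, ~ is_cycle u s.

(* [typeI] is the set of vertices of Type I, its complement that of Type II. *)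
Definition is_biregular_tree (a b : nat) : Prop :=
  is_tree /\
  exists typeI : set (vertex G), forall v,
    (typeI v -> neighbours v #= `I_a /\ neighbours v `<=` ~` typeI) /\
    (~ typeI v -> neighbours v #= `I_b /\ neighbours v `<=` typeI).

End Graph.

Section Game.
Variables (G : multigraph) (p q : nat).

(* A play consists of the sets [m n] and [d n] of edges that Maker marks and
   Breaker deletes in round n, for n = 0, 1, ... *)
Implicit Types (m d : nat -> {fset edge G}).

(* The edges chosen by a player before round n. *)
Definition chosen m (n : nat) : {fset edge G} := \big[fsetU/fset0]_(i < n) m i.

Definition maker_legal m d (n : nat) : Prop :=
  #|` m n| = p /\ [disjoint m n & chosen m n `|` chosen d n]%fset.

(* Breaker moves after Maker's n-th move, whence [chosen m n.+1]. *)
Definition breaker_legal m d (n : nat) : Prop :=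
  #|` d n| = q /\ [disjoint d n & chosen m n.+1 `|` chosen d n]%fset.

(* A strategy determines Maker's next move from the list of Breaker's previous
   moves; her own previous moves are then determined as well. *)
Definition maker_strategy := seq {fset edge G} -> {fset edge G}.

Definition maker_play (sigma : maker_strategy) d : nat -> {fset edge G} :=
  fun n => sigma (mkseq d n).

(* Components only shrink, so it is enough to inspect the graph between rounds.
   Only the first n entries of d matter for the conclusion about round n. *)
Definition maker_winning_strategy (v0 : vertex G) (sigma : maker_strategy) :=
  forall d n, let m := maker_play sigma d in
    (forall i, (i < n)%N -> breaker_legal m d i) ->
    maker_legal m d n /\ infinite_set (component (chosen d n) v0).

Definition maker_wins (v0 : vertex G) : Prop :=
  exists sigma : maker_strategy, maker_winning_strategy v0 sigma.

End Game.

(* Main.v *)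
Require Import Defs.
From mathcomp Require Import all_boot all_order all_algebra finmap zify.
From mathcomp Require Import boolp classical_sets functions cardinality.
From Stdlib Require Import Relation_Operators Operators_Properties.

(* Root the tree at [v0], so that every edge has a lower end.  Extending the
   safe component of the root by an edge changes the number of edges leaving it
   by [a - 2] or [b - 2], according to the type of the lower end.  Each vertex
   of Type I gives access to at most [a - 1] vertices of Type II, so in a turn
   that starts without spare edges leading to Type II at least [c = ceil (p / a)]
   of the [p] edges have a lower end of Type I, and the gain is at most
   [p (b - 2) - c (b - a)].

   If [q] does not exceed this gain, Maker grows her component greedily inside
   the branches that contain no deleted edge.  Each deletion spoils at most one
   such branch, so their number never decreases.

   Otherwise Breaker pretends that the marked edges form a rooted subtree: a
   mark made away from the subtree is replaced by an edge leaving the subtree,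
   chosen so that Hall's condition matches the marked edges with edges of the
   subtree above them.  He cuts off [q] edges leaving the subtree, those leading
   to Type II first; if such an edge is already marked, he deletes an unmarked
   edge above it.  If [r] edges leading to Type II are left, the number of
   leaving edges plus [(b - a) * ceil (r / a)] decreases in each round, so that
   the component of the root eventually becomes finite. *)

Set Implicit Arguments.
Unset Strict Implicit.
Unset Printing Implicit Defensive.

Local Open Scope fset_scope.
Local Open Scope nat_scope.

(** * Arithmetic and finite sets *)

(** As [c <= p], splitting [b - 2] into [(b - a) + (a - 2)] leaves [p * (a - 2) < q]. The bound pays
    for rounding up: it gives [a * c <= p + q]. *)
Lemma ceil_gain_lower p q a b c : 0 < p -> 2 <= a <= b -> p <= a * c < p + a ->
  p * (b - 2) < q + c * (b - a) -> a.-1 <= q.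
Proof.
move=> p0 /andP[a2 ab] /andP[_ cp].
have -> : b - 2 = (b - a) + (a - 2) by lia.
have cle : c <= p by nia.
have : c * (b - a) <= p * (b - a) by rewrite leq_mul2r cle orbT.
have : a - 2 <= p * (a - 2) by rewrite leq_pmull.
lia.
Qed.

Lemma fsub_card (K : choiceType) (A B : {fset K}) :
  {subset A <= B} -> #|` A| <= #|` B|.
Proof. by move=> AB; apply/fsubset_leq_card/fsubsetP. Qed.

Lemma fsubset_between (K : choiceType) (A B : {fset K}) (k : nat) :
  A `<=` B -> #|` A| <= k <= #|` B| ->
  exists C : {fset K}, [/\ A `<=` C, C `<=` B & #|` C| = k].
Proof.
move=> AB /andP[]; elim: k => [|k IHk] Ak kB.
  by exists A; split=> //; lia.
case: (ltngtP #|` A| k.+1) Ak => // [Ak _|<- _]; last by exists A.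
have [C [AC CB Ck]] := IHk Ak (ltnW kB).
have [x xB xC] : exists2 x, x \in B & x \notin C.
  case: (fset_0Vmem (B `\` C)) => [BC0|[x]]; last first.
    by rewrite in_fsetD => /andP[xC xB]; exists x.
  have := fsubset_leq_card (_ : B `<=` C); rewrite -fsetD_eq0 BC0 eqxx.
  by move=> /(_ isT); lia.
exists (x |` C); split; last by rewrite cardfsU1 xC Ck.
  by apply: fsubset_trans AC _; apply: fsubsetU1.
by apply/fsubsetP => y; rewrite in_fset1U => /predU1P[->//|]; apply/fsubsetP.
Qed.

Lemma in_fset_sep (K : choiceType) (A : {fset K}) (c : pred K) x :
  (x \in [fset y in A | c y]) = (x \in A) && c x.
Proof. by rewrite !inE. Qed.

(** * Rooted trees of edges *)

(* The edges of a rooted tree: [par] is the next edge towards the root,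
   [kids None] the edges at the root and [kids (Some e)] the edges hanging from
   the lower end of [e]; [bot1 e] says that this end is of Type I. *)
Record edge_tree (E : choiceType) (a b : nat) := EdgeTree {
  par : E -> option E;
  lvl : E -> nat;
  kids : option E -> {fset E};
  bot1 : E -> bool;
  par_lvl : forall e f, par e = Some f -> lvl e = (lvl f).+1;
  in_kids : forall o e, (e \in kids o) = (par e == o);
  card_kids : forall e, #|` kids (Some e)| = (if bot1 e then a else b).-1;
  kids_root : kids None != fset0;
  par_bot1 : forall e f, par e = Some f -> bot1 e = ~~ bot1 f
}.

Definition count_fset (E : choiceType) (c : pred E) (X : {fset E}) : nat :=
  #|` [fset e in X | c e]|.

Lemma count_fsetT (E : choiceType) (X : {fset E}) :
  count_fset predT X = #|` X|.
Proof. by rewrite /count_fset; congr #|` _|; apply/fsetP => e; rewrite !inE andbT. Qed.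

Section CountFset.
Variables (E : choiceType) (c : pred E).
Implicit Types X Y : {fset E}.

Lemma count_fset1 y : count_fset c [fset y] = c y.
Proof.
rewrite /count_fset; have [cy|ncy] := boolP (c y).
  rewrite /= -[RHS](cardfs1 y); congr #|` _|; apply/fsetP => e; rewrite !inE.
  by have [->|] := eqVneq e y.
apply/eqP; rewrite cardfs_eq0; apply/eqP/fsetP => e; rewrite !inE.
by have [->|] := eqVneq e y; rewrite ?(negbTE ncy).
Qed.

Lemma count_fset_sub X Y : {subset X <= Y} -> count_fset c X <= count_fset c Y.
Proof.
by move=> XY; apply: fsub_card => e; rewrite !in_fset_sep => /andP[/XY -> ->].
Qed.

Lemma count_fsetU_leq X Y :
  count_fset c (X `|` Y) <= count_fset c X + count_fset c Y.
Proof.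
rewrite -cardfsUI (leq_trans _ (leq_addr _ _)) //.
by apply: fsub_card => e; rewrite in_fsetU !in_fset_sep in_fsetU andb_orl.
Qed.

Lemma count_fsetU X Y : [disjoint X & Y] ->
  count_fset c (X `|` Y) = count_fset c X + count_fset c Y.
Proof.
move=> /fdisjointP XY; rewrite -cardfsUI.
rewrite [X in _ + #|` X|](_ : _ = fset0) ?cardfs0 ?addn0.
  congr #|` _|; apply/fsetP => e.
  by rewrite in_fsetU !in_fset_sep in_fsetU andb_orl.
apply/fsetP => e; rewrite in_fsetI !in_fset_sep in_fset0.
by apply/negP => /andP[/andP[/XY/negbTE ->]].
Qed.

End CountFset.

Section EdgeTree.
Variables (E : choiceType) (a b : nat) (t : edge_tree E a b).
Implicit Types (e f x y z : E) (M D V A X : {fset E}).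

Notation par := (par t).
Notation lvl := (lvl t).
Notation kids := (kids t).
Notation bot1 := (bot1 t).

(** [n] is fuel; the level of [e] suffices, since it drops by one at each step towards the root. *)
Fixpoint path_to_root_rec n e : seq E :=
  e :: (if n is n'.+1 then oapp (path_to_root_rec n') [::] (par e) else [::]).

Definition path_to_root e := path_to_root_rec (lvl e) e.
Notation P := path_to_root.

Lemma path_to_rootE e : P e = e :: oapp P [::] (par e).
Proof.
rewrite /P; case pe: (par e) => [f|] /=.
  by rewrite (par_lvl pe) /= pe.
by case: (lvl e) => [|n] //=; rewrite pe.
Qed.

Lemma edge_ind (Q : E -> Prop) :
  (forall e, (forall f, par e = Some f -> Q f) -> Q e) -> forall e, Q e.
Proof.
move=> IH e; have [n] := ubnP (lvl e); elim: n e => // n IHn e le.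
by apply: IH => f pe; apply: IHn; have := par_lvl pe; lia.
Qed.

Lemma mem_path_to_root x e :
  (x \in P e) = (x == e) || (if par e is Some f then x \in P f else false).
Proof. by rewrite path_to_rootE in_cons; case: (par e). Qed.

Lemma path_refl e : e \in P e.
Proof. by rewrite mem_path_to_root eqxx. Qed.

Lemma path_par e f x : par e = Some f -> x \in P f -> x \in P e.
Proof. by move=> pe xf; rewrite mem_path_to_root pe xf orbT. Qed.

Lemma path_trans x y z : x \in P y -> y \in P z -> x \in P z.
Proof.
move=> xy; elim/edge_ind: z => z IH; rewrite mem_path_to_root.
case/orP => [/eqP<-//|]; case pz: (par z) => [w|//] yw.
exact: path_par pz (IH _ pz yw).
Qed.

Lemma path_total x y z : x \in P z -> y \in P z -> (x \in P y) || (y \in P x).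
Proof.
elim/edge_ind: z => z IH xz yz; move: (xz) (yz).
rewrite [x \in _]mem_path_to_root => /orP[/eqP->|]; first by rewrite yz orbT.
rewrite mem_path_to_root; case pz: (par z) => [w|//] xw /orP[/eqP->|yw].
  by rewrite xz.
exact: IH pz xw yw.
Qed.

(** The finite sets of this kind are the edge sets of subtrees containing the root. *)
Definition upclosed A := forall e f, e \in A -> par e = Some f -> f \in A.

Lemma closed_path A x y : upclosed A -> x \in A -> y \in P x -> y \in A.
Proof.
move=> cA; elim/edge_ind: x => x IH xA; rewrite mem_path_to_root.
by case/orP => [/eqP->//|]; case px: (par x) => [w|//]; apply: IH => //; apply: cA px.
Qed.

Lemma path_closed x : upclosed [fset y in P x].
Proof.
move=> e f; rewrite !inE => ex pe; apply: path_trans ex.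
by apply: path_par pe _; apply: path_refl.
Qed.

Definition boundary M : {fset E} :=
  locked ((kids None `|` \bigcup_(f <- M) kids (Some f)) `\` M).

Lemma in_boundary M e :
  (e \in boundary M) = (e \notin M) && (if par e is Some f then f \in M else true).
Proof.
rewrite /boundary -lock in_fsetD in_fsetU; congr (_ && _).
rewrite in_kids; case pe: (par e) => [f|] /=; last by [].
apply/bigfcupP/idP => [[g /andP[gM _]]|fM].
  by rewrite in_kids pe => /eqP[->].
by exists f; rewrite ?fM // in_kids pe.
Qed.

Lemma boundary_inside A V x : upclosed A -> x \in A -> x \notin V ->
  exists2 f, f \in A & f \in boundary V.
Proof.
move=> cA; elim/edge_ind: x => x IH xA xV.
case px: (par x) => [y|]; last by exists x => //; rewrite in_boundary xV px.
have yA := cA _ _ xA px; have [yV|yV] := boolP (y \in V); last exact: IH px yA yV.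
by exists x => //; rewrite in_boundary xV px.
Qed.

Lemma closedU1 M y : upclosed M -> y \in boundary M -> upclosed (y |` M).
Proof.
move=> cM; rewrite in_boundary => /andP[_ pyM] e f.
rewrite !inE => /predU1P[->|eM] pe; last by rewrite (cM _ _ eM pe) orbT.
by rewrite pe in pyM; rewrite pyM orbT.
Qed.

(** Two edges above [z] are comparable. Were one boundary edge strictly above another, the parent of
    the lower one, being in [M], would force the upper one into [M]. *)
Lemma boundary_antichain M x y z : upclosed M -> x \in boundary M ->
  y \in boundary M -> x \in P z -> y \in P z -> x = y.
Proof.
move=> cM; have main u v : u \in boundary M -> v \in boundary M -> u \in P v -> u = v.
  rewrite !in_boundary => /andP[uM _] /andP[_ vM].
  rewrite mem_path_to_root => /orP[/eqP//|].
  case pv: (par v) vM => [w|//] wM uw.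
  by rewrite (closed_path cM wM uw) in uM.
move=> xM yM xz yz; case/orP: (path_total xz yz); first exact: main.
by move=> /main ->.
Qed.

Definition bot2 e := ~~ bot1 e.

Lemma count_kids_bot2 y : count_fset bot2 (kids (Some y)) = if bot1 y then a.-1 else 0.
Proof.
have kb e : e \in kids (Some y) -> bot2 e = bot1 y.
  by rewrite in_kids => /eqP /par_bot1; rewrite /bot2 => ->; rewrite negbK.
rewrite /count_fset; case: ifP => by1.
  have := card_kids t y; rewrite by1 => <-.
  congr #|` _|; apply/fsetP => e; rewrite !inE.
  by apply: andb_idr => /kb; rewrite by1.
apply/eqP; rewrite cardfs_eq0; apply/eqP/fsetP => e; rewrite !inE.
by apply/negP => /andP[/kb ->]; rewrite by1.
Qed.

Lemma boundaryU1 M y e : upclosed M -> y \in boundary M ->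
  (e \in boundary (y |` M)) = (e \in boundary M) && (e != y) || (e \in kids (Some y)).
Proof.
move=> cM; rewrite !in_boundary in_kids !inE negb_or => /andP[yM pyM].
case pe: (par e) => [f|] /=; last by rewrite !andbT orbF andbC.
rewrite [Some f == _](_ : _ = (f == y)) // !inE.
have [fy|fy] := eqVneq f y; last by rewrite orbF -!andbA; do !bool_congr.
rewrite fy in pe; rewrite orbT andbT; apply/andP; split.
  by apply: contra_eq_neq pe => ->; apply/negP => /eqP/par_lvl; lia.
by apply: contra yM => eM; apply: cM pe.
Qed.

(** * Growth in undamaged branches *)

(** The condition on [D] says that nothing at or below [e] is deleted. *)
Definition free_boundary M D : {fset E} :=
  locked [fset e in boundary M | all (fun d => e \notin P d) D].

Lemma in_free_boundary M D e : (e \in free_boundary M D) =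
  (e \in boundary M) && all (fun d => e \notin P d) D.
Proof. by rewrite /free_boundary -lock in_fset_sep. Qed.

(** The branch at [y] is undamaged, hence so are those at its children: [y] is traded for all of
    them. The predicate [c] allows counting all edges or only those leading to Type II. *)
Lemma free_boundaryU1 M D y (c : pred E) : upclosed M -> y \in free_boundary M D ->
  count_fset c (free_boundary M D) + count_fset c (kids (Some y)) <=
  count_fset c (free_boundary (y |` M) D) + c y.
Proof.
move=> cM yf; have := yf; rewrite in_free_boundary => /andP[yb /allP yD].
rewrite -count_fsetU; last first.
  apply/fdisjointP => e; rewrite in_free_boundary in_boundary in_kids.
  move=> /andP[/andP[_ pM] _]; apply/negP => /eqP pe; rewrite pe in pM.
  by move: yb; rewrite in_boundary pM.
rewrite -(count_fset1 c y); apply: leq_trans (count_fsetU_leq _ _ _).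
apply: count_fset_sub => e; rewrite !in_fsetU in_fset1 !in_free_boundary boundaryU1 //.
have [//|ey] := eqVneq e y; rewrite ?orbT // !orbF !andbT.
case/orP => [/andP[-> ->] //|ek]; rewrite ek orbT /=.
apply/allP => d /yD; apply: contra; apply: path_trans.
by move: ek; rewrite in_kids => /eqP pe; apply: path_par pe _; apply: path_refl.
Qed.

Hypotheses (a2 : 2 <= a) (ab : a <= b).

(* Greedy growth: take a free boundary edge with lower end of Type II whenever
   there is one.  The lower bound [r >= a * i - k] on the number of such edges
   shows that an edge with lower end of Type I is only taken if [a * i <= k]. *)
Lemma free_growth M D k : upclosed M -> free_boundary M D != fset0 ->
  exists m i, [/\ #|` m| = k, [disjoint m & M `|` D], upclosed (m `|` M),
    free_boundary (m `|` M) D != fset0 & a * i <= k + a.-1 /\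
    #|` free_boundary M D| + k * (b - 2) <=
    #|` free_boundary (m `|` M) D| + i * (b - a)].
Proof.
move=> cM fM.
suff [m [i [mk mD cm fm [ai [Bm _]]]]] : exists m i,
    [/\ #|` m| = k, [disjoint m & M `|` D], upclosed (m `|` M),
    free_boundary (m `|` M) D != fset0 & a * i <= k + a.-1 /\
    (#|` free_boundary M D| + k * (b - 2) <=
     #|` free_boundary (m `|` M) D| + i * (b - a) /\
     a * i <= count_fset bot2 (free_boundary (m `|` M) D) + k)].
  by exists m, i.
elim: k => [|k [m [i [mk mD cm fm [ai [Bm rm]]]]]].
  exists fset0, 0; rewrite cardfs0 fset0U muln0; split=> //.
  by apply/fdisjointP => x; rewrite inE.
have [y yf yr] : exists2 y, y \in free_boundary (m `|` M) D &
    bot1 y -> count_fset bot2 (free_boundary (m `|` M) D) = 0.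
  case: (fset_0Vmem [fset e in free_boundary (m `|` M) D | bot2 e]) => [r0|[y]].
    by case/fset0Pn: fm => y yf; exists y => // _; rewrite /count_fset r0 cardfs0.
  by rewrite inE /= => /andP[yf /negbTE yb]; exists y => //; rewrite yb.
have yb : y \in boundary (m `|` M) by move: yf; rewrite in_free_boundary => /andP[].
have : y \notin m `|` M by move: yb; rewrite in_boundary => /andP[].
rewrite in_fsetU negb_or => /andP[ym yM].
have yD : y \notin D.
  apply/negP => yD; move: yf; rewrite in_free_boundary => /andP[_ /allP /(_ _ yD)].
  by rewrite path_refl.
have := free_boundaryU1 predT cm yf; have := free_boundaryU1 bot2 cm yf.
rewrite !count_fsetT count_kids_bot2 card_kids fsetUA [_ y]/= => Hr HB.
exists (y |` m), (i + bot1 y).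
have := @in_free_boundary (y |` m `|` M) D.
move: (free_boundary (y |` m `|` M) D) Hr HB => F Hr HB inF.
rewrite [bot2 y]/bot2 in Hr.
have kids_ne : kids (Some y) != fset0.
  rewrite -cardfs_eq0 card_kids.
  by case: ifP => _; rewrite -lt0n -ltnS prednK ?(leq_trans a2) ?(leq_trans _ ab) // ltnW.
split.
- by rewrite cardfsU1 ym mk.
- rewrite fdisjointU1X mD andbT in_fsetU negb_or yM; exact: yD.
- by rewrite -fsetUA; apply: closedU1.
- have [x xk] := fset0Pn _ kids_ne.
  apply/fset0Pn; exists x; rewrite inF -fsetUA boundaryU1 // xk orbT /=.
  move: yf; rewrite in_free_boundary => /andP[_ /allP yP].
  apply/allP => d /yP; apply: contra; apply: path_trans.
  by move: xk; rewrite in_kids => /eqP pe; apply: path_par pe _; apply: path_refl.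
case: (bot1 y) Hr HB yr => /= Hr HB yr; split.
- by rewrite (yr isT) in rm; lia.
- by split; nia.
- by lia.
- by split; nia.
Qed.

Lemma free_boundary_delete M D d : upclosed M ->
  #|` free_boundary M D| <= #|` free_boundary M (D `|` d)| + #|` d|.
Proof.
(* [hit e] is the boundary edge above [e], unique by [boundary_antichain], with default [e] if there
   is none. Every edge that ceases to be free is hit by an edge of [d]. *)
move=> cM; pose hit e := head e [seq x <- P e | x \in boundary M].
apply: leq_trans (_ : #|` free_boundary M (D `|` d) `|` hit @` d| <= _).
  apply: fsub_card => e; rewrite in_fsetU !in_free_boundary => /andP[eb /allP eD].
  rewrite eb /=; case: (boolP (all _ _)) => //= /allPn[x xd /negPn ex].
  apply/imfsetP; exists x => /=.
    by move: xd; rewrite inE => /orP[/eD|//]; rewrite ex.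
  have : e \in [seq x <- P x | x \in boundary M] by rewrite mem_filter eb.
  rewrite /hit; case def: [seq _ <- _ | _] => [//|f s] _ /=.
  have : f \in [seq x <- P x | x \in boundary M] by rewrite def mem_head.
  rewrite mem_filter => /andP[fb fx]; exact: (boundary_antichain cM eb fb ex fx).
rewrite cardfsU; have := leq_imfset_card imfset_key hit (mem d); rewrite /=.
move=> /(leq_trans _) H; apply: leq_trans (leq_subr _ _) _.
by rewrite leq_add2l; apply: H.
Qed.

Lemma edges_infinite k : exists m : {fset E}, #|` m| = k.
Proof.
have c0 : upclosed fset0 by move=> e f; rewrite inE.
suff f0 : free_boundary fset0 fset0 != fset0.
  by have [m [i [mk _ _ _ _]]] := free_growth k c0 f0; exists m.
have [x xk] := fset0Pn _ (kids_root t); apply/fset0Pn; exists x.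
move: xk; rewrite in_free_boundary in_boundary in_kids => /eqP ->.
by rewrite !inE; apply/allP => d; rewrite inE.
Qed.

(** * Breaker's virtual subtree *)

Definition active D e := all (fun f => f \notin D) (P e).

Definition live V D : {fset E} := locked (boundary V `\` D).

Lemma in_live V D e : (e \in live V D) = (e \in boundary V) && (e \notin D).
Proof. by rewrite /live -lock in_fsetD andbC. Qed.

Definition all_active D V := forall e, e \in V -> active D e.

Lemma active_notin D e : active D e -> e \notin D.
Proof. by move/allP; apply; apply: path_refl. Qed.

Lemma active_path D x y : active D y -> x \in P y -> active D x.
Proof.
by move=> /allP yD xy; apply/allP => z zx; apply: yD; apply: path_trans zx xy.
Qed.

Lemma active_live V D e : all_active D V -> e \in live V D -> active D e.
Proof.
move=> aV; rewrite in_live in_boundary => /andP[/andP[_ pV] eD].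
apply/allP => x; rewrite mem_path_to_root => /predU1P[->//|].
by case: (par e) pV => [f|//] /aV /allP fD /fD.
Qed.

Lemma all_activeU1 V D f : all_active D V -> f \in live V D ->
  all_active D (f |` V).
Proof.
move=> aV fl e; rewrite in_fset1U => /predU1P[->|/aV//].
exact: active_live fl.
Qed.

(* Breaker pretends that the marked edges form the rooted subtree [V].  Hall's
   condition says that the marked edges can be matched with edges of [V] lying
   above them, so that [V] contains the safe component of the root. *)
Definition hall M D V := forall A, upclosed A -> all_active D A ->
  #|` A `&` M| <= #|` A `&` V|.

(* The minimal tight set [A] containing [e] lies in every tight set containing
   [e], so any element of [A] may be added to [V] to compensate for [e]. *)
Lemma hall_mark M D V e : hall M D V -> upclosed V -> all_active D V ->
  e \notin M -> live V D != fset0 ->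
  exists2 f, f \in live V D & hall (e |` M) D (f |` V).
Proof.
move=> hV cV aV eM lV.
pose tight A := [/\ upclosed A, all_active D A, e \in A & #|` A `&` M| = #|` A `&` V|].
(* Adding [e] and [f] can violate Hall's condition only at a tight set that contains [e] but not
   [f]. *)
have key f : f \in live V D -> (forall A, tight A -> f \in A) ->
    hall (e |` M) D (f |` V).
  move=> fl fA A cA aA; have := hV A cA aA.
  have fV : f \notin V by move: fl; rewrite in_live in_boundary => /andP[/andP[]].
  have cardI1 x Y : x \notin Y -> #|` A `&` (x |` Y)| = (x \in A) + #|` A `&` Y|.
    move=> xY; have [xA|xA] := boolP (x \in A).
      rewrite (_ : A `&` (x |` Y) = x |` (A `&` Y)) ?cardfsU1 ?in_fsetI ?(negbTE xY) ?andbF //.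
      by apply/fsetP => z; rewrite !inE; have [->|] := eqVneq z x; rewrite ?xA.
    congr #|` _|; apply/fsetP => z; rewrite !inE.
    by have [->|] := eqVneq z x; rewrite ?(negbTE xA).
  rewrite !cardI1 //; have [eA|_] := boolP (e \in A); last by lia.
  rewrite leq_eqVlt => /orP[/eqP tA|]; last by lia.
  by rewrite fA ?tA.
have [[A tA]|noA] := pselect (exists A, tight A); last first.
  have [f fl] := fset0Pn _ lV; exists f => //; apply: key => // A tA.
  by case: noA; exists A.
have exn : exists n, `[< exists2 A, tight A & #|` A| = n >].
  by exists #|` A|; apply/asboolP; exists A.
case: (ex_minnP exn) => n /asboolP[{tA}A [cA aA eA tA] An] minA.
(* If [A] were inside [V], tightness would put [A] inside [M], although [e] is unmarked. *)
have [x xA xV] : exists2 x, x \in A & x \notin V.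
  have [/fsubsetP AV|] := boolP (A `<=` V); last by case/fsubsetPn=> x; exists x.
  have : e \in A `&` M.
    have -> : A `&` M = A; last by [].
    apply/eqP; rewrite eqEfcard fsubsetIl tA /=; apply: fsub_card => z zA.
    by rewrite in_fsetI zA AV.
  by rewrite in_fsetI (negbTE eM) andbF.
have [f fA fb] := boundary_inside cA xA xV.
have fl : f \in live V D by rewrite in_live fb active_notin ?aA.
exists f => //; apply: key => // B [cB aB eB tB].
have cI : upclosed (A `&` B).
  move=> z w; rewrite !in_fsetI => /andP[zA zB] pz.
  by rewrite (cA _ _ zA pz) (cB _ _ zB pz).
have cU : upclosed (A `|` B).
  move=> z w; rewrite !in_fsetU => /orP[zA|zB] pz.
    by rewrite (cA _ _ zA pz).
  by rewrite (cB _ _ zB pz) orbT.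
have aI : all_active D (A `&` B) by move=> z; rewrite in_fsetI => /andP[/aA].
have aU : all_active D (A `|` B).
  by move=> z; rewrite in_fsetU => /orP[/aA|/aB].
(* Both sides of Hall's condition are modular in the closed set, so tightness of [A] and [B] passes
   to their intersection; minimality then puts [A] inside [B]. *)
have modular Y : #|` (A `|` B) `&` Y| + #|` (A `&` B) `&` Y| =
    #|` A `&` Y| + #|` B `&` Y|.
  rewrite -[RHS]cardfsUI; congr addn; congr #|` _|; apply/fsetP => z; rewrite !inE.
    by rewrite andb_orl.
  by case: (z \in A); case: (z \in B); case: (z \in Y).
have tI : #|` (A `&` B) `&` M| = #|` (A `&` B) `&` V|.
  have := modular M; have := modular V; have := hV _ cI aI; have := hV _ cU aU.
  by lia.
have : #|` A| <= #|` A `&` B|.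
  rewrite An; apply: minA; apply/asboolP; exists (A `&` B) => //; split=> //.
  by rewrite in_fsetI eA.
move=> AB; have /eqP AE : A `&` B == A by rewrite eqEfcard fsubsetIl.
by move: fA; rewrite -AE in_fsetI => /andP[].
Qed.

(** [f] gives way to its children, some of which may already be deleted; hence only an
    inequality. *)
Lemma liveU1 V D f (c : pred E) : upclosed V -> f \in live V D ->
  count_fset c (live (f |` V) D) + c f <=
  count_fset c (live V D) + count_fset c (kids (Some f)).
Proof.
move=> cV; rewrite in_live => /andP[fb fD].
rewrite -(count_fset1 c f) -count_fsetU; last first.
  apply/fdisjointP => e; rewrite in_live in_boundary in_fset1U in_fset1 negb_or.
  by move=> /andP[/andP[/andP[]]].
apply: leq_trans (count_fsetU_leq _ _ _).
apply: count_fset_sub => e; rewrite in_fsetU in_live in_fset1 in_fsetU in_live.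
rewrite boundaryU1 //; case/orP => [/andP[/orP[/andP[-> _] -> //|->]]|/eqP ->].
  by rewrite orbT.
by rewrite fb fD.
Qed.

(** One use of [hall_mark] per marked edge; [i] counts the edges added to [V] with lower end of Type
    I. Such an edge adds at most [a - 2] live edges instead of [b - 2], and at most [a - 1] leading
    to Type II, where the others remove one. *)
Lemma breaker_marks (s : seq E) M N D V : hall M D V -> upclosed V ->
  all_active D V -> uniq s -> {in s, forall e, e \notin M} ->
  (forall x, (x \in N) = (x \in M) || (x \in s)) ->
  (forall V, upclosed V -> all_active D V -> live V D != fset0) ->
  exists W i, [/\ hall N D W, upclosed W, all_active D W,
    #|` live W D| + i * (b - a) <= #|` live V D| + size s * (b - 2) &
    count_fset bot2 (live W D) + size s <= count_fset bot2 (live V D) + a * i].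
Proof.
elim: s M V => [|e s IHs] M V hV cV aV.
  move=> _ _ NM _; exists V, 0; rewrite (_ : N = M); last first.
    by apply/fsetP => x; rewrite NM orbF.
  by split=> //=; rewrite !(mul0n, muln0).
move=> /= /andP[es us] sM NM lD.
have eM : e \notin M by apply: sM; rewrite mem_head.
have [f fl hf] := hall_mark hV cV aV eM (lD _ cV aV).
have fb : f \in boundary V by move: fl; rewrite in_live => /andP[].
have [x xs|x|W [i [hW cW aW BW rW]]] :=
  IHs _ _ hf (closedU1 cV fb) (all_activeU1 aV fl) us _ _ lD; last first.
- exists W, (i + bot1 f).
  have := liveU1 predT cV fl; have := liveU1 bot2 cV fl.
  rewrite !count_fsetT count_kids_bot2 card_kids [bot2 f]/bot2.
  by case: (bot1 f) => /= rf Bf; split=> //; nia.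
- by rewrite NM in_cons in_fset1U orbCA orbA.
- rewrite in_fset1U negb_or sM ?in_cons ?xs ?orbT // andbT.
  by apply: contraNneq es => <-.
Qed.

Lemma breaker_deletes M D V X q : hall M D V -> upclosed V -> all_active D V ->
  X `<=` live V D -> #|` X| <= q ->
  exists d W, [/\ #|` d| = q, [disjoint d & M `|` D],
    hall M (D `|` d) W & [/\ upclosed W, all_active (D `|` d) W &
    live W (D `|` d) `<=` live V D `\` X]].
Proof.
move=> hV cV aV /fsubsetP XV Xq.
(* If the whole path to [x] were marked, Hall's condition for this path would put [x] in [V], but
   live edges are outside [V]. *)
have unmarked x : x \in X -> exists2 z, z \in P x & z \notin M.
  move=> xX; have xl := XV _ xX.
  have [PM|/allPn[z zx zM]] := boolP (all (fun z => z \in M) (P x)); last by exists z.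
  have aP : all_active D [fset z in P x].
    by move=> z; rewrite !inE => /(active_path (active_live aV xl)).
  have PV : [fset z in P x] `&` V = [fset z in P x].
    apply/eqP; rewrite eqEfcard fsubsetIl /=.
    apply: leq_trans (hV _ (@path_closed x) aP); apply: fsub_card => z zx.
    by rewrite in_fsetI zx; move: zx; rewrite !inE => /(allP PM).
  have : x \in [fset z in P x] by rewrite inE path_refl.
  rewrite -PV in_fsetI andbC => /andP[xV _]; move: xl.
  by rewrite in_live in_boundary xV.
pose g x := head x [seq z <- P x | z \notin M].
have gP x : x \in X -> g x \in P x /\ g x \notin M.
  move=> /unmarked[z zx zM]; have : z \in [seq z <- P x | z \notin M].
    by rewrite mem_filter zM.
  rewrite /g; case def: [seq _ <- _ | _] => [//|f s] _ /=.
  have : f \in [seq z <- P x | z \notin M] by rewrite def mem_head.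
  by rewrite mem_filter => /andP[].
have gD x : x \in X -> g x \notin D.
  move=> xX; apply: active_notin; have [gx _] := gP _ xX.
  exact: active_path (active_live aV (XV _ xX)) gx.
(* [F] is large enough to supply [q] fresh edges. They fill up the move, since [g] may yield fewer
   than [q] edges. *)
have [F Fcard] := edges_infinite (q + #|` M `|` D|).
pose Z := g @` X.
have Zq : #|` Z| <= q by apply: leq_trans Xq; apply: leq_imfset_card.
have ZF : q <= #|` Z `|` (F `\` (M `|` D))|.
  apply: (@leq_trans #|` F `\` (M `|` D)|); last exact/fsub_card/fsubsetP/fsubsetUr.
  rewrite cardfsD Fcard; have := fsubset_leq_card (fsubsetIr F (M `|` D)); lia.
have [|d [Zd dF dq]] := fsubset_between (fsubsetUl Z (F `\` (M `|` D))) (k := q).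
  by rewrite Zq.
(* The new subtree is the part of [V] that the deletions leave joined to the root. *)
exists d, [fset e in V | active (D `|` d) e].
have cW : upclosed [fset e in V | active (D `|` d) e].
  move=> e f; rewrite !in_fset_sep => /andP[eV eD] pe; rewrite (cV _ _ eV pe).
  by apply: active_path eD _; apply: path_par pe _; apply: path_refl.
have aW : all_active (D `|` d) [fset e in V | active (D `|` d) e].
  by move=> e; rewrite in_fset_sep => /andP[].
have actD e : active (D `|` d) e -> active D e.
  by apply: sub_all => z; rewrite in_fsetU negb_or => /andP[].
split=> //.
- apply/fdisjointP => z /(fsubsetP dF); rewrite in_fsetU => /orP[].
    by case/imfsetP => x /= xX ->; rewrite in_fsetU negb_or gD // (gP _ xX).2.
  by rewrite in_fsetD => /andP[].
- move=> A cA aA; apply: leq_trans (hV _ cA _) _; first by move=> e /aA /actD.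
  by apply: fsub_card => e; rewrite !in_fsetI in_fset_sep => /andP[eA ->]; rewrite eA aA.
split=> //; apply/fsubsetP => e el; have ea := active_live aW el.
move: el; rewrite in_live in_boundary in_fset_sep ea andbT => /andP[/andP[eV pe] _].
rewrite in_fsetD in_live in_boundary eV (active_notin (actD _ ea)) andbT.
apply/andP; split.
  apply/negP => eX; have [ge _] := gP _ eX.
  have := active_notin (active_path ea ge).
  by rewrite in_fsetU (fsubsetP Zd) ?orbT //; apply: in_imfset.
by case: (par e) pe => [f|//]; rewrite in_fset_sep => /andP[].
Qed.

(* With [c] the ceiling of [p / a], the potential [#|live| + (b - a) * R]
   decreases in each round, where [a * R] bounds the number of live edges with
   lower end of Type II, which Breaker deletes first. *)
Lemma breaker_turn p q c M D V R (m : {fset E}) : 0 < p -> p <= a * c < p + a ->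
  p * (b - 2) < q + c * (b - a) ->
  #|` m| = p -> [disjoint m & M] ->
  (forall V, upclosed V -> all_active D V -> live V D != fset0) ->
  hall M D V -> upclosed V -> all_active D V ->
  count_fset bot2 (live V D) <= a * R ->
  exists d W S, [/\ #|` d| = q, [disjoint d & (M `|` m) `|` D],
    hall (M `|` m) (D `|` d) W & [/\ upclosed W, all_active (D `|` d) W,
    count_fset bot2 (live W (D `|` d)) <= a * S &
    #|` live W (D `|` d)| + (b - a) * S < #|` live V D| + (b - a) * R]].
Proof.
move=> p0 /andP[pc cp] hq mp mM lD hV cV aV rR.
have q0 : a.-1 <= q by apply: ceil_gain_lower hq; rewrite ?a2 ?pc.
have [|V1 [i [hV1 cV1 aV1 B1 r1]]] := breaker_marks hV cV aV (fset_uniq m) _ (in_fsetU M m) lD.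
  by move=> e em; apply: (fdisjointP mM).
rewrite mp in B1 r1.
have B0 : 0 < #|` live V D| by rewrite cardfs_gt0 lD.
have finish X : X `<=` live V1 D -> #|` X| <= q -> forall S,
    count_fset bot2 (live V1 D `\` X) <= a * S ->
    #|` live V1 D `\` X| + (b - a) * S < #|` live V D| + (b - a) * R ->
    exists d W S, [/\ #|` d| = q, [disjoint d & (M `|` m) `|` D],
    hall (M `|` m) (D `|` d) W & [/\ upclosed W, all_active (D `|` d) W,
    count_fset bot2 (live W (D `|` d)) <= a * S &
    #|` live W (D `|` d)| + (b - a) * S < #|` live V D| + (b - a) * R]].
  move=> XV Xq S rS BS.
  have [d [W [dq dM hW [cW aW lW]]]] := breaker_deletes hV1 cV1 aV1 XV Xq.
  exists d, W, S; split=> //; split=> //.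
    by apply: leq_trans rS; apply: count_fset_sub; apply/fsubsetP.
  by apply: leq_ltn_trans BS; rewrite leq_add2r; apply: fsubset_leq_card.
have [Bq|qB] := leqP #|` live V1 D| q.
  apply: (finish (live V1 D)) (_ : _ <= _) 0 _ _ => //; rewrite fsetDv.
    by rewrite muln0 leqn0 cardfs_eq0; apply/eqP/fsetP => e; rewrite !inE.
  by rewrite cardfs0 muln0 addn0 ltn_addr.
pose L2 := [fset e in live V1 D | bot2 e].
have L2V : L2 `<=` live V1 D.
  by apply/fsubsetP => e; rewrite in_fset_sep => /andP[].
have cardD X : X `<=` live V1 D -> #|` live V1 D `\` X| = #|` live V1 D| - #|` X|.
  by move=> /fsetIidPr XV; rewrite cardfsD XV.
(* [r1] and [rR] give [p <= a * (i + R)], and [c] is the least number with [p <= a * c]. *)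
have iR : c <= i + R by clear - a2 pc cp r1 rR; nia.
have kiR : c * (b - a) <= (i + R) * (b - a) by rewrite leq_mul2r iR orbT.
(* If all live edges leading to Type II can be cut, the new bound [S] is 0 and the spare deletions
   go to other live edges. *)
have [rq|qr] := leqP #|` L2| q.
  have [|X [LX XV Xq]] := fsubset_between L2V (k := q); first by rewrite rq ltnW.
  apply: (finish X) (_ : _ <= _) 0 _ _ => //; first by rewrite Xq.
    rewrite muln0 leqn0 cardfs_eq0; apply/eqP/fsetP => e.
    rewrite in_fset_sep in_fsetD in_fset0.
    apply/negP => /andP[/andP[/negP eX eV] e2]; apply: eX.
    by apply: (fsubsetP LX); rewrite in_fset_sep eV.
  by rewrite cardD // Xq muln0 (mulnC (b - a)); rewrite mulnDl in kiR; lia.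
have [|X [_ XL Xq]] := fsubset_between (fsub0set L2) (k := q).
  by rewrite cardfs0 leq0n ltnW.
have XV := fsubset_trans XL L2V.
(* All [q] deletions now hit edges leading to Type II. The bound [i + R - c] is valid because [q0]
   gives [a * c <= p + q]. *)
apply: (finish X) (_ : _ <= _) (i + R - c) _ _ => //; first by rewrite Xq.
  have -> : count_fset bot2 (live V1 D `\` X) = #|` L2| - q.
    have <- : #|` L2 `\` X| = #|` L2| - q.
      by rewrite cardfsD; move/fsetIidPr: XL => ->; rewrite Xq.
    congr #|` _|; apply/fsetP => e; rewrite in_fset_sep !in_fsetD in_fset_sep.
    by rewrite andbA.
  have {}r1 : #|` L2| + p <= count_fset bot2 (live V D) + a * i := r1.
  by rewrite mulnBr mulnDr; lia.
by rewrite cardD // Xq mulnBr mulnDr !(mulnC (b - a)); rewrite mulnDl in kiR; lia.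
Qed.

End EdgeTree.

(** * Rooting an acyclic multigraph *)

Lemma not_uniq_map (T : Type) (U : eqType) (f : T -> U) (s : seq T) :
  ~~ uniq (map f s) ->
  exists s1 x s2 y s3, s = s1 ++ x :: s2 ++ y :: s3 /\ f x = f y.
Proof.
elim: s => //= x s IHs; rewrite negb_and negbK => /orP[xs|/IHs].
  have [s2 [y [s3 [-> fxy]]]] : exists s2 y s3, s = s2 ++ y :: s3 /\ f x = f y.
    elim: s xs {IHs} => //= z s IHs; rewrite in_cons => /orP[/eqP fxz|/IHs].
      by exists [::], z, s.
    by move=> [s2 [y [s3 [-> fxy]]]]; exists (z :: s2), y, s3.
  by exists [::], x, s2, y, s3.
by move=> [s1 [y [s2 [z [s3 [-> fyz]]]]]]; exists (x :: s1), y, s2, z, s3.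
Qed.

Section RootedTree.
Variable G : multigraph.
Implicit Types (u v w : vertex G) (e f : edge G).
Implicit Types (s t : seq (edge G * vertex G)).

Lemma joins_sym e u v : joins e u v -> joins e v u.
Proof. by case; [right|left]. Qed.

Lemma joins_cases e u v u' v' : joins e u v -> joins e u' v' ->
  (u = u' /\ v = v') \/ (u = v' /\ v = u').
Proof. by rewrite /joins => -[]-> [] [-> ->]; auto. Qed.

Lemma joins_other e u u' v : joins e u v -> joins e u' v -> u = u'.
Proof. by move=> j /(joins_cases j) [[]|[-> ->]]. Qed.

Definition walk_end u s := last u (unzip2 s).

Definition last_edge s : option (edge G) := last None [seq Some x.1 | x <- s].

Definition nonbacktracking s := sorted (fun x y => x.1 != y.1) s.

Lemma walk_end_rcons u s x : walk_end u (rcons s x) = x.2.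
Proof. by rewrite /walk_end /unzip2 map_rcons last_rcons. Qed.

Lemma last_edge_rcons s x : last_edge (rcons s x) = Some x.1.
Proof. by rewrite /last_edge map_rcons last_rcons. Qed.

Lemma walk_cat u s t : walk u (s ++ t) <-> walk u s /\ walk (walk_end u s) t.
Proof.
elim: s u => [|[e v] s IHs] u /=; first by split=> [|[]].
by split=> [[? /IHs[]]|[[? ?] ?]]; split=> //; apply/IHs.
Qed.

Lemma walk_rcons u s e v :
  walk u (rcons s (e, v)) <-> walk u s /\ joins e (walk_end u s) v.
Proof.
by rewrite -cats1; split=> [/walk_cat[? []]|[? ?]] //; apply/walk_cat.
Qed.

Lemma nonbacktracking_rcons s x :
  nonbacktracking (rcons s x) = nonbacktracking s && (last_edge s != Some x.1).
Proof.
case: s => //= y s; rewrite /nonbacktracking /= rcons_path; congr (_ && _).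
rewrite /last_edge /= -[Some y.1]/((fun z => Some z.1) y) last_map.
by rewrite (inj_eq Some_inj).
Qed.

Lemma nonbacktracking_infix s1 s2 s3 :
  nonbacktracking (s1 ++ s2 ++ s3) -> nonbacktracking s2.
Proof. by move=> /cat_sorted2[_ /cat_sorted2[]]. Qed.

(* A shortest closed walk without backtracking is a cycle. *)
Lemma closed_walk_nil u s : (forall u s, ~ is_cycle (G := G) u s) ->
  walk u s -> nonbacktracking s -> walk_end u s = u -> s = [::].
Proof.
move=> acyclic; have [n] := ubnP (size s); elim: n u s => // n IHn u s sn ws ns cs.
have [us|] := boolP (uniq (unzip2 s)); last first.
  (* The stretch between two visits of [v] is a shorter closed walk without backtracking. *)
  move=> /not_uniq_map[s1 [[e v] [s2 [y [s3 [sE vy]]]]]]; rewrite {}sE in sn ws ns cs.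
  move: ws => /walk_cat[_ [_]]; rewrite -cat_rcons => /walk_cat[ws _].
  rewrite -cat_rcons -(cat_rcons y) in ns; have {}ns := nonbacktracking_infix ns.
  have := IHn _ _ _ ws ns; rewrite walk_end_rcons size_rcons => H.
  suff /(congr1 size) : rcons s2 y = [::] by rewrite size_rcons.
  by apply: H => //; move: sn; rewrite size_cat /= size_cat /=; lia.
case s0 : (nilp s); first exact/nilP.
case: (acyclic u s); split=> //; first by move=> s0'; rewrite s0' in s0.
(* A second traversal of [e] in the same direction repeats [v]; one in the opposite direction
   repeats [v] too, unless it follows at once and so backtracks. *)
apply/negPn/negP => /not_uniq_map[s1 [[e v] [s2 [[f w] [s3 [sE /= ef]]]]]].
rewrite -{f}ef in sE; rewrite {}sE in ws ns us.
move: ws => /walk_cat[_ /= [j1 /walk_cat[_ /= [j2 _]]]].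
move: us; rewrite /unzip2 map_cat /= map_cat cat_uniq => /and3P[_ _ /= /andP[vs _]].
move: vs; rewrite mem_cat in_cons !negb_or => /and3P[vs2 vw _].
have [[_ vE]|[_ vE]] := joins_cases j1 j2; first by rewrite vE eqxx in vw.
have s20 : s2 = [::].
  case/lastP: s2 vs2 vE {j1 j2 ns} => // s2 x; rewrite walk_end_rcons => + vE.
  by rewrite map_rcons mem_rcons in_cons vE eqxx.
rewrite s20 /= in ns; move: ns => /cat_sorted2[_] /=.
by rewrite eqxx.
Qed.

(** If the last edge [e] of [t] is not that of [s], then [s] followed by [e] backwards ends where
    [t] without [e] does. By induction the latter also ends in [e], so [t] backtracks. *)
Lemma closing_walk u s t : (forall u s, ~ is_cycle (G := G) u s) ->
  walk u s -> nonbacktracking s -> walk u t -> nonbacktracking t ->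
  walk_end u s = walk_end u t -> last_edge s = last_edge t.
Proof.
move=> acyclic; elim/last_ind: t s => [|t [e v] IHt] s ws ns.
  by move=> _ _ sE; rewrite (closed_walk_nil acyclic ws ns).
move=> /walk_rcons[wt jt]; rewrite nonbacktracking_rcons => /andP[nt et].
rewrite walk_end_rcons last_edge_rcons /= => sE.
have [//|es] := eqVneq (last_edge s) (Some e).
have := IHt (rcons s (e, walk_end u t)).
rewrite walk_end_rcons last_edge_rcons nonbacktracking_rcons ns es /=.
move=> H; case/eqP: et; apply/esym; apply: H => //.
by apply/walk_rcons; split=> //; rewrite sE; apply: joins_sym.
Qed.

Lemma walk_unique u s t : (forall u s, ~ is_cycle (G := G) u s) ->
  walk u s -> nonbacktracking s -> walk u t -> nonbacktracking t ->
  walk_end u s = walk_end u t -> s = t.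
Proof.
move=> acyclic; elim/last_ind: s t => [|s [e v] IHs] t ws ns wt nt st.
  have := closing_walk acyclic ws ns wt nt st.
  by case/lastP: t {wt nt st} => // t x; rewrite last_edge_rcons.
have := closing_walk acyclic ws ns wt nt st; rewrite last_edge_rcons.
case/lastP: t wt nt st => [//|t [f w]] wt nt; rewrite !walk_end_rcons /= => vw.
rewrite last_edge_rcons => -[/= ef]; rewrite -{f}ef -{w}vw in wt nt *.
move: ws wt ns nt => /walk_rcons[ws js] /walk_rcons[wt jt].
rewrite !nonbacktracking_rcons => /andP[ns _] /andP[nt _].
by rewrite (IHs t) //; apply: joins_other js jt.
Qed.

(** * Routes from the root and the two ends of an edge *)

Section Rooted.
Variables (v0 : vertex G) (a b : nat) (typeI : set (vertex G)).
Hypothesis tree : is_tree G.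

Let acyclic := tree.2.

(** Along a chain of adjacencies, each new edge is appended, or cancels the last edge if they
    coincide. *)
Lemma route_exists w :
  exists s, [/\ walk v0 s, nonbacktracking s & walk_end v0 s = w].
Proof.
have /(clos_rt_rtn1 _ _ _ _) H := tree.1 v0 w.
elim: w / H => [|w w' [e _ j] _ [s [ws ns sw]]]; first by exists [::].
have [es|es] := eqVneq (last_edge s) (Some e); last first.
  exists (rcons s (e, w')); split; last by rewrite walk_end_rcons.
    by apply/walk_rcons; rewrite sw.
  by rewrite nonbacktracking_rcons ns es.
case/lastP: s es ws ns sw => // s [f x]; rewrite last_edge_rcons walk_end_rcons.
move=> [/= fe] + + xw; rewrite {f}fe {x}xw => /walk_rcons[ws js].
rewrite nonbacktracking_rcons => /andP[ns _]; exists s; split=> //.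
by apply: joins_other js (joins_sym j).
Qed.

Definition route w := sval (cid (route_exists w)).

Lemma routeP w :
  [/\ walk v0 (route w), nonbacktracking (route w) & walk_end v0 (route w) = w].
Proof. exact: svalP (cid (route_exists w)). Qed.

Lemma route_eq w s : walk v0 s -> nonbacktracking s -> walk_end v0 s = w ->
  route w = s.
Proof.
move=> ws ns sw; have [wr nr rw] := routeP w.
by apply: (walk_unique acyclic wr nr ws ns); rewrite rw.
Qed.

Lemma route_rcons e u v : joins e u v -> last_edge (route u) <> Some e ->
  route v = rcons (route u) (e, v).
Proof.
move=> j /eqP eu; have [wu nu uE] := routeP u.
apply: route_eq; last by rewrite walk_end_rcons.
  by apply/walk_rcons; rewrite uE.
by rewrite nonbacktracking_rcons nu eu.
Qed.

Lemma route_last e w : last_edge (route w) = Some e ->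
  exists2 u, joins e u w & route w = rcons (route u) (e, w).
Proof.
have [] := routeP w; case/lastP: (route w) => // s [f x].
rewrite last_edge_rcons walk_end_rcons nonbacktracking_rcons.
move=> /walk_rcons[ws js] /andP[ns _] /= xw [fe]; rewrite {f}fe {x}xw in js *.
by exists (walk_end v0 s) => //; rewrite (route_eq ws ns).
Qed.

Lemma route_root : route v0 = [::].
Proof. exact: route_eq. Qed.

(** The end nearer to [v0]; [route_lower] rules out a tie. *)
Definition upper e :=
  let: (u, v) := ends e in if size (route u) < size (route v) then u else v.

Definition lower e :=
  let: (u, v) := ends e in if size (route u) < size (route v) then v else u.

Lemma joins_ends e : joins e (upper e) (lower e).
Proof. by rewrite /joins /upper /lower; case: (ends e) => u v; case: ifP; auto. Qed.

Lemma route_lower e : route (lower e) = rcons (route (upper e)) (e, lower e).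
Proof.
have size_leq : size (route (upper e)) <= size (route (lower e)).
  by rewrite /upper /lower; case: (ends e) => u v; case: ltnP => // /ltnW.
have [eu|/eqP eu] := eqVneq (last_edge (route (upper e))) (Some e); last first.
  exact: route_rcons (joins_ends e) eu.
have [u j uE] := route_last eu.
have ul : u = lower e by apply: joins_other j (joins_sym (joins_ends e)).
by move: size_leq; rewrite uE size_rcons ul ltnn.
Qed.

Lemma last_edge_route e w : last_edge (route w) = Some e <-> lower e = w.
Proof.
split=> [ew|<-]; last by rewrite route_lower last_edge_rcons.
have [u j uE] := route_last ew.
have [[_ //]|[ul wu]] := joins_cases (joins_ends e) j.
have := route_lower e; rewrite wu ul uE => /(congr1 size).
by rewrite !size_rcons; lia.
Qed.

Lemma last_edge_root w : last_edge (route w) = None <-> w = v0.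
Proof.
split=> [|->]; last by rewrite route_root.
have [_ _] := routeP w.
by case/lastP: (route w) => [<-//|s x] _; rewrite last_edge_rcons.
Qed.

Lemma lower_inj : injective lower.
Proof. by move=> e f /last_edge_route; rewrite route_lower last_edge_rcons => -[]. Qed.

Lemma lower_neq_root e : lower e <> v0.
Proof. by move/last_edge_route; rewrite route_root. Qed.

Lemma upper_or_lower e u v : joins e u v ->
  (upper e = u /\ lower e = v) \/ (upper e = v /\ lower e = u).
Proof. by move=> /(joins_cases (joins_ends e)). Qed.

Lemma neighboursE w :
  (neighbours w = [set lower e | e in [set e | upper e = w]] `|`
                  [set upper e | e in [set e | lower e = w]])%classic.
Proof.
apply/seteqP; split=> v /=.
  by case=> e _ /upper_or_lower [[uw <-]|[<- lw]]; [left|right]; exists e.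
by case=> -[e /= <- <-]; exists e; rewrite ?inE //;
  [apply: joins_ends|apply/joins_sym/joins_ends].
Qed.

Hypotheses (a2 : 2 <= a) (b2 : 2 <= b).
Hypothesis biregular : forall v,
  (typeI v -> neighbours v #= `I_a /\ neighbours v `<=` ~` typeI)%classic%card /\
  (~ typeI v -> neighbours v #= `I_b /\ neighbours v `<=` typeI)%classic%card.

Let deg w := if `[< typeI w >] then a else b.

Lemma neighbours_card w : (neighbours w #= `I_(deg w))%card.
Proof.
by rewrite /deg; have [bI bII] := biregular w; case: asboolP => [/bI[]|/bII[]].
Qed.

Lemma lower_typeI e : `[< typeI (lower e) >] = ~~ `[< typeI (upper e) >].
Proof.
have nb : neighbours (upper e) (lower e).
  by exists e; rewrite ?inE //; apply: joins_ends.
have [bI bII] := biregular (upper e); case: asboolP => /=.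
  by move=> lI; apply/esym/asboolPn => /bI[_ /(_ _ nb)].
move=> lI; apply/esym/negbTE; rewrite negbK; apply/asboolP; apply: contrapT => uI.
by apply: lI; apply: (bII uI).2.
Qed.

Definition neighbour_fset w := fset_set (neighbours w).

Lemma in_neighbour_fset w v : (v \in neighbour_fset w) = `[< neighbours w v >].
Proof.
by rewrite in_fset_set ?inE //; apply/finite_setP; exists (deg w); apply: neighbours_card.
Qed.

Definition down w := fset_set [set e | upper e = w]%classic.

Lemma in_down w e : (e \in down w) = (upper e == w).
Proof.
rewrite in_fset_set; first by apply/idP/eqP; rewrite inE.
apply: (@sub_finite_set _ _ (lower @^-1` neighbours w)%classic).
  by move=> f /= <-; exists f; rewrite ?inE //; apply: joins_ends.
apply: finite_preimage; first by move=> e1 e2 _ _; apply: lower_inj.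
by apply/finite_setP; exists (deg w); apply: neighbours_card.
Qed.

(** [lower] maps [down w] injectively to the neighbours of [w], missing only the upper end of the
    edge that leads to [w], if any. *)
Lemma card_down w : #|` down w| =
  if last_edge (route w) is Some _ then (deg w).-1 else deg w.
Proof.
have <- : #|` lower @` down w| = #|` down w| by apply: card_imfset; apply: lower_inj.
have nw : #|` neighbour_fset w| = deg w by apply: card_fset_set; apply: neighbours_card.
case ew : (last_edge (route w)) => [e|].
  have le : lower e = w by apply/last_edge_route.
  have -> : lower @` down w = neighbour_fset w `\ upper e.
    apply/fsetP => v; rewrite in_fsetD1 in_neighbour_fset neighboursE.
    apply/imfsetP/andP => /= [[f]|[vu /asboolP[][f /= fw fv]]].
    - rewrite in_down => /eqP fw ->; split; last by apply/asboolP; left; exists f.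
      apply/eqP => fe; have := route_lower e; have := route_lower f.
      by rewrite fw -le fe => -> /(congr1 size); rewrite !size_rcons; lia.
    - by exists f; rewrite // in_down fw.
    - have fe : f = e by apply: lower_inj; rewrite fw.
      by rewrite -fv fe eqxx in vu.
  rewrite cardfsD nw (_ : _ `&` _ = [fset upper e]) ?cardfs1 ?subn1 //.
  apply/fsetP => v; rewrite in_fsetI in_fset1 in_neighbour_fset neighboursE andbC.
  by apply: andb_idr => /eqP ->; apply/asboolP; right; exists e.
rewrite -nw; congr #|` _|; apply/fsetP => v; rewrite in_neighbour_fset neighboursE.
apply/imfsetP/asboolP => /= [[f]|[][f /= fw fv]].
- by rewrite in_down => /eqP fw ->; left; exists f.
- by exists f; rewrite // in_down fw.
- by move/last_edge_route: fw; rewrite ew.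
Qed.

Definition parent_edge e := last_edge (route (upper e)).

Definition edges_below (o : option (edge G)) := down (if o is Some e then lower e else v0).

Lemma in_edges_below o e : (e \in edges_below o) = (parent_edge e == o).
Proof.
rewrite in_down; apply/eqP/eqP; case: o => [f|]; rewrite /parent_edge.
- by move=> ->; apply/last_edge_route.
- by move=> ->; apply/last_edge_root.
- by move/last_edge_route.
- by move/last_edge_root.
Qed.

Lemma card_edges_below e :
  #|` edges_below (Some e)| = (if `[< typeI (lower e) >] then a else b).-1.
Proof. by rewrite card_down route_lower last_edge_rcons. Qed.

Lemma edges_below_root : edges_below None != fset0.
Proof.
by rewrite -cardfs_eq0 card_down route_root /deg /=; case: asboolP => _; lia.
Qed.

Lemma parent_edge_level e f : parent_edge e = Some f ->
  size (route (upper e)) = (size (route (upper f))).+1.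
Proof. by move/last_edge_route <-; rewrite route_lower size_rcons. Qed.

Lemma parent_edge_typeI e f : parent_edge e = Some f ->
  `[< typeI (lower e) >] = ~~ `[< typeI (lower f) >].
Proof. by move/last_edge_route ->; apply: lower_typeI. Qed.

Definition rooted_tree : edge_tree (edge G) a b :=
  EdgeTree parent_edge_level in_edges_below card_edges_below edges_below_root
    parent_edge_typeI.

Lemma component_active D e : active rooted_tree D e -> component D v0 (lower e).
Proof.
elim/(edge_ind (t := rooted_tree)): e => e IH ae.
have eD : e \notin D := active_notin ae.
have adj : adjacent D (upper e) (lower e) by exists e => //; apply: joins_ends.
case pe : (parent_edge e) => [f|].
  have fe : lower f = upper e by apply/last_edge_route.
  apply: rt_trans (rt_step _ _ _ _ adj); rewrite -fe; apply: (IH f) => //.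
  by apply: active_path ae _; apply: path_par (path_refl _ _).
by have /last_edge_root <- := pe; apply: rt_step.
Qed.

(** Along a path from [v0], a step down prolongs an active route; a step up retraces the last edge
    of the route, by [lower_inj]. *)
Lemma component_inv D w : component D v0 w ->
  w = v0 \/ exists2 e, active rooted_tree D e & lower e = w.
Proof.
move=> /(clos_rt_rtn1 _ _ _ _) H; elim: w / H => [|w w' [e eD j] _ IH].
  by left.
have [[uw <-]|[<- lw]] := upper_or_lower j.
  right; exists e => //; apply/allP => f; rewrite mem_path_to_root => /predU1P[->//|].
  rewrite /= /parent_edge uw; case: IH => [->|[g ag gw]]; first by rewrite route_root.
  by have /last_edge_route -> := gw; apply: (allP ag).
case: IH => [w0|[g ag gw]]; first by case: (@lower_neq_root e); rewrite lw.
have ge : g = e by apply: lower_inj; rewrite gw.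
case pe : (parent_edge e) => [f|]; last by left; apply/last_edge_root.
right; exists f; last by apply/last_edge_route.
by apply: active_path ag _; rewrite ge; apply: path_par (path_refl _ _).
Qed.

End Rooted.
End RootedTree.

(** * The game *)

Section Percolation.
Variables (G : multigraph) (p q a b : nat) (typeI : set (vertex G)) (v0 : vertex G).
Hypothesis tree : is_tree G.
Hypotheses (a2 : 2 <= a) (b2 : 2 <= b) (ab : a <= b).
Hypothesis biregular : forall v,
  (typeI v -> neighbours v #= `I_a /\ neighbours v `<=` ~` typeI)%classic%card /\
  (~ typeI v -> neighbours v #= `I_b /\ neighbours v `<=` typeI)%classic%card.
Implicit Types M D V : {fset edge G}.

Let t := rooted_tree v0 tree a2 b2 biregular.

Lemma chosen0 (m : nat -> {fset edge G}) : chosen m 0 = fset0.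
Proof. by rewrite /chosen big_ord0. Qed.

Lemma chosenS (m : nat -> {fset edge G}) n : chosen m n.+1 = chosen m n `|` m n.
Proof. by rewrite /chosen big_ord_recr. Qed.

Lemma eq_chosen (m m' : nat -> {fset edge G}) n :
  (forall i, i < n -> m i = m' i) -> chosen m n = chosen m' n.
Proof. by move=> mm'; apply: eq_bigr => i _; apply: mm'. Qed.

(** * Maker's strategy *)

Definition maker_safe M D :=
  [/\ upclosed t M, [disjoint M & D] & free_boundary t M D != fset0].

(** Growing by one edge more than the component has vertices is absurd: the lower ends of the new
    edges are distinct and lie in the component. *)
Lemma maker_safe_infinite M D : maker_safe M D -> infinite_set (component D v0).
Proof.
move=> [cM MD fM] fin.
have [m [i [mk mMD cm _ _]]] := free_growth a2 ab #|` fset_set (component D v0)|.+1 cM fM.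
have : #|` lower v0 tree @` m| = #|` m| by apply: card_imfset; apply: lower_inj.
rewrite mk => /eqP; apply/negP; rewrite neq_ltn; apply/orP; left.
rewrite ltnS; apply: fsub_card => _ /imfsetP[e /= em ->].
rewrite in_fset_set // inE.
apply: (component_active (a2 := a2) (b2 := b2) (biregular := biregular)).
apply/allP => f fe.
have : f \in m `|` M by apply: closed_path cm _ fe; rewrite in_fsetU em.
rewrite in_fsetU => /orP[/(fdisjointP mMD)|]; last exact/fdisjointP.
by rewrite in_fsetU negb_or => /andP[].
Qed.

Lemma maker_turn c M D : p <= a * c -> q + c * (b - a) <= p * (b - 2) ->
  maker_safe M D -> exists m : {fset edge G}, [/\ #|` m| = p, [disjoint m & M `|` D] &
    forall d : {fset edge G}, #|` d| = q -> [disjoint d & M `|` m] ->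
      maker_safe (M `|` m) (D `|` d)].
Proof.
move=> pc qp [cM MD fM].
have [m [i [mk mMD cm _ [ai Bm]]]] := free_growth a2 ab p cM fM.
exists m; split=> // d dq dMm; split; first by rewrite fsetUC.
  move: mMD dMm; rewrite fdisjointXU => /andP[_ mD] dMm.
  by rewrite fdisjointXU fdisjointUX MD mD /= fdisjoint_sym.
rewrite fsetUC -cardfs_gt0; have := free_boundary_delete D d cm.
(* Hence the gain [p * (b - 2) - i * (b - a)] is at least [q], the most that Breaker can spoil. *)
have ic : i <= c by clear - a2 ai pc; nia.
have : i * (b - a) <= c * (b - a) by rewrite leq_mul2r ic orbT.
have : 0 < #|` free_boundary t M D| by rewrite cardfs_gt0.
by rewrite dq; lia.
Qed.

Lemma maker_wins_if c : p <= a * c -> q + c * (b - a) <= p * (b - 2) ->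
  maker_wins p q v0.
Proof.
move=> pc qp.
(* A strategy sees only Breaker's moves: a reply is chosen for each pair of marked and deleted sets,
   [fset0] for unsafe pairs, and a fold recomputes the pair. *)
have [mv mvP] : exists mv : {fset edge G} * {fset edge G} -> {fset edge G},
    forall st, maker_safe st.1 st.2 ->
    [/\ #|` mv st| = p, [disjoint mv st & st.1 `|` st.2] &
    forall d : {fset edge G}, #|` d| = q -> [disjoint d & st.1 `|` mv st] ->
      maker_safe (st.1 `|` mv st) (st.2 `|` d)].
  have ex st : exists m : {fset edge G}, maker_safe st.1 st.2 ->
      [/\ #|` m| = p, [disjoint m & st.1 `|` st.2] &
      forall d : {fset edge G}, #|` d| = q -> [disjoint d & st.1 `|` m] ->
      maker_safe (st.1 `|` m) (st.2 `|` d)].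
    have [/(maker_turn pc qp)[m mP]|nsafe] := pselect (maker_safe st.1 st.2).
      by exists m.
    by exists fset0.
  by have [mv mvP] := choice ex; exists mv.
pose step st d := (st.1 `|` mv st, st.2 `|` d).
pose state := foldl step (fset0, fset0).
exists (fun ds => mv (state ds)) => d n m legal.
have stateE k : state (mkseq d k) = (chosen m k, chosen d k).
  elim: k => [|k IHk]; first by rewrite !chosen0.
  have mE : m k = mv (state (mkseq d k)) by [].
  by rewrite mkseqS /state foldl_rcons -/(state _) !chosenS mE IHk.
have safe k : k <= n -> maker_safe (chosen m k) (chosen d k).
  elim: k => [|k IHk] kn.
    rewrite !chosen0; split; first by move=> e f; rewrite inE.
      by apply/fdisjointP => e; rewrite inE.
    have [x xk] := fset0Pn _ (kids_root t); apply/fset0Pn; exists x.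
    move: xk; rewrite in_free_boundary in_boundary in_kids => /eqP ->.
    by rewrite !inE; apply/allP => y; rewrite inE.
  have [dq] := legal _ kn; rewrite fdisjointXU => /andP[dm _].
  have [_ _ H] := mvP (chosen m k, chosen d k) (IHk (ltnW kn)).
  have mE : mv (chosen m k, chosen d k) = m k by rewrite -stateE.
  by rewrite /= mE in H; rewrite !chosenS; apply: H; rewrite -?chosenS.
split; last exact: maker_safe_infinite (safe n _).
have [mp mMD _] := mvP (chosen m n, chosen d n) (safe n (leqnn n)).
by rewrite /maker_legal /m /maker_play stateE.
Qed.

(** * Breaker's counterplay *)

(** Without live edges every active edge would lie in [V], confining the component to [v0] and the
    lower ends of [V]. *)
Lemma infinite_live D V : infinite_set (component D v0) -> upclosed t V ->
  all_active t D V -> live t V D != fset0.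
Proof.
move=> inf cV aV; apply/negP => /eqP l0; apply: inf.
pose F : {fset vertex G} := v0 |` lower v0 tree @` V.
apply: (@sub_finite_set _ _ [set` F]) => //.
move=> w /(@component_inv _ _ _ _ _ tree a2 b2 biregular) [->|[e ae <-]].
  by rewrite /= !inE eqxx.
rewrite /= in_fset1U; apply/orP; right; apply: in_imfset.
apply/negPn/negP => eV.
have ePe : e \in [fset f in path_to_root t e] by rewrite inE path_refl.
have [f] := boundary_inside (@path_closed _ _ _ t e) ePe eV.
rewrite inE => fe fb; have : f \in live t V D; last by rewrite l0.
by rewrite in_live fb (active_notin (active_path ae fe)).
Qed.

Lemma not_maker_wins c : 0 < p -> p <= a * c < p + a -> p * (b - 2) < q + c * (b - a) ->
  ~ maker_wins p q v0.
Proof.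
move=> p0 pc qp [sigma win].
(* Induction on a strict bound [N] for the potential. Initially [R = B] will do, as [B <= a * B]. *)
suff H N n d V R : (forall i, i < n -> breaker_legal q (maker_play sigma d) d i) ->
    hall t (chosen (maker_play sigma d) n) (chosen d n) V -> upclosed t V ->
    all_active t (chosen d n) V ->
    count_fset (bot2 t) (live t V (chosen d n)) <= a * R ->
    #|` live t V (chosen d n)| + (b - a) * R < N -> False.
  pose B := count_fset (bot2 t) (live t fset0 fset0).
  apply: (H _ 0 (fun=> fset0) fset0 B _ _ _ _ _ (ltnSn _)) => //.
  - by move=> A _ _; rewrite chosen0 !fsetI0.
  - by rewrite chosen0 -/B leq_pmull // ltnW.
elim: N n d V R => // N IHN n d V R legal hV cV aV rR BN.
have [[mp mMD] inf] := win d n legal.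
have mM : [disjoint maker_play sigma d n & chosen (maker_play sigma d) n].
  by move: mMD; rewrite fdisjointXU => /andP[].
have [d0 [W [S [dq dM hW [cW aW rS BS]]]]] := breaker_turn a2 ab p0 pc qp mp mM
  (fun V => @infinite_live _ V inf) hV cV aV rR.
(* Round [n] receives the reply [d0], which also fills later rounds as a placeholder. Maker's moves
   up to round [n] stay the same, as they depend only on earlier rounds. *)
pose d' i := if i < n then d i else d0.
have dE i : i < n -> d' i = d i by rewrite /d' => ->.
have mE i : i <= n -> maker_play sigma d' i = maker_play sigma d i.
  move=> le_in; rewrite /maker_play; congr sigma; apply/eq_in_map => j.
  by rewrite mem_iota /= => ji; apply: dE; apply: leq_trans le_in.
have cdE i : i <= n -> chosen d' i = chosen d i.
  by move=> le_in; apply: eq_chosen => j ji; apply: dE; apply: leq_trans le_in.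
have cmE i : i <= n.+1 ->
    chosen (maker_play sigma d') i = chosen (maker_play sigma d) i.
  by move=> le_in; apply: eq_chosen => j ji; apply: mE; rewrite -ltnS (leq_trans ji).
have dn : d' n = d0 by rewrite /d' ltnn.
have cdS : chosen d' n.+1 = chosen d n `|` d0 by rewrite chosenS cdE // dn.
apply: (IHN n.+1 d' W S); rewrite ?cdS ?cmE ?chosenS //; last exact: leq_trans BS _.
move=> i; rewrite ltnS leq_eqVlt => /predU1P[->|lt_in].
  by rewrite /breaker_legal dn cmE // cdE // chosenS.
rewrite /breaker_legal cmE ?ltnS ?(ltnW lt_in) // cdE ?(ltnW lt_in) // dE //.
exact: legal.
Qed.

End Percolation.

(** * The ceiling and the final equivalence *)

Import Order.TTheory GRing.Theory Num.Theory.
Local Open Scope ring_scope.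

Lemma ceil_ratio (p a c : nat) : (0 < a)%N -> (p <= a * c < p + a)%N ->
  Num.ceil (p%:Q / a%:Q) = c%:Z.
Proof.
move=> a0 /andP[pc cp]; apply: ceil_def.
have a0' : 0 < a%:Q :> rat by rewrite ltr0z.
rewrite ltr_pdivlMr // ler_pdivrMr // -!intrM ltr_int ler_int; lia.
Qed.

Theorem theorem1p7 (p q a b : nat) (hp : (0 < p)%N) (hq : (0 < q)%N)
    (ha : (2 <= a)%N) (hab : (a <= b)%N)
    (T : multigraph) (hT : is_biregular_tree T a b) (v0 : vertex T) :
  maker_wins p q v0 <->
  p%:Z * (b%:Z - 2%:Z) - Num.ceil (p%:Q / a%:Q) * (b%:Z - a%:Z) >= q%:Z.
Proof.
have [tree [typeI biregular]] := hT.
have b2 := leq_trans ha hab; have a0 := ltnW ha.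
(* The ceiling of [p / a] as a natural number. *)
pose c := ((p + a.-1) %/ a)%N.
have pc : (p <= a * c < p + a)%N.
  have := divn_eq (p + a.-1) a; have := ltn_pmod (p + a.-1) a0.
  by rewrite -/c mulnC; lia.
have -> : (q%:Z <= p%:Z * (b%:Z - 2%:Z) - Num.ceil (p%:Q / a%:Q) * (b%:Z - a%:Z))
    = (q + c * (b - a) <= p * (b - 2))%N.
  by rewrite (ceil_ratio a0 pc) (subzn b2) (subzn hab) -!PoszM lerBrDr -PoszD.
split=> [|qp]; last first.
  by have /andP[pc' _] := pc; apply: (maker_wins_if v0 tree ha b2 hab biregular pc' qp).
apply: contraPT; rewrite -ltnNge => qp.
exact: (not_maker_wins tree ha b2 hab biregular hp pc qp).
Qed.
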